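(* For any integers $k, m \ge 1$, $$\sum_{\lambda} |\lambda| = \frac{mk (k - 1) ((m + 1)k + 2)}{24 (mk + 1)} \binom{(m + 1)k}{k},$$ where $\lambda$ is summed over all $(k, mk + 1)$-core partitions.
   Context: A partition is a finite (possibly empty) nonincreasing sequence $\lambda = (\lambda_1, \ldots, \lambda_r)$ of positive integers; its size is $|\lambda| = \sum_{i=1}^r \lambda_i$. The Young diagram of $\lambda$ is the collection of $r$ left-justified rows of cells with $\lambda_i$ cells in row $i$. The hook length of a cell $C$ of the Young diagram is the number of cells that are in the same row as $C$ and to its right, or in the same column as $C$ and below it, or equal to $C$. For positive integers $a, b$, a partition is an $(a,b)$-core if no cell of its Young diagram has hook length equal to $a$ or $b$. (For $\gcd(a,b)=1$ there are only finitely many $(a,b)$-cores.) *)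

(* Defs.v *)
From mathcomp Require Import all_boot.

Set Implicit Arguments.
Unset Strict Implicit.
Unset Printing Implicit Defensive.

Definition is_partition (la : seq nat) : bool := sorted geq la && (0 \notin la).

Definition psize (la : seq nat) : nat := sumn la.

(* The cell (i, j) lies in row i and column j, both numbered from 0, with rows
   numbered downwards. *)
Definition young_diagram (la : seq nat) : seq (nat * nat) :=
  [seq (i, j) | i <- iota 0 (size la), j <- iota 0 (nth 0 la i)].

Definition in_hook (c d : nat * nat) : bool :=
  [|| (d.1 == c.1) && (c.2 < d.2), (d.2 == c.2) && (c.1 < d.1) | d == c].

Definition hook_length (la : seq nat) (c : nat * nat) : nat :=
  count (in_hook c) (young_diagram la).

Definition is_core (a b : nat) (la : seq nat) : bool :=
  is_partition la &&
  all (fun c => (hook_length la c != a) && (hook_length la c != b))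
      (young_diagram la).

(* Main.v *)
(* Record a partition [la] by its beta-set X, the hook lengths of its first
   column. The hook lengths in a row with first-column hook length x are the
   t with 0 < t <= x and x - t outside X, so [la] is a t-core iff X is closed
   under subtracting t whenever possible. Hence a (k, b)-core with b = mk + 1 is
   given by the numbers n_j of elements of X in the residue classes j mod k,
   subject to n_0 = 0 and n_(j+1) <= n_j + m, and the steps n_j + m - n_(j+1)
   (with n_k = 0, and one more unit in the last step) form a weak composition z
   of b into k parts whose partial sums stay below the line j * b / k.

   Let h_j = j * b - k * (z_0 + ... + z_(j-1)) = j + k * n_j. The size of the core is
   (sum_(i,j) (h_i - h_j)^2) / (4k^2) - (k^2 - 1) / 24, which makes sense for every
   weak composition and is invariant under cyclic rotation of z. As each rotation
   class contains exactly one ballot composition (start at the lowest height),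
   the sum over cores is 1/k times the sum over all weak compositions, which
   only involves the first two moments of the parts. *)
Require Import Defs.
From mathcomp Require Import all_boot all_order all_algebra finmap.
From mathcomp Require Import zify ring lra.
Import Order.TTheory GRing.Theory Num.Theory.

Set Implicit Arguments.
Unset Strict Implicit.

(** * Partitions and their beta-sets *)

Lemma geq_trans : transitive geq.
Proof. exact: rev_trans leq_trans. Qed.

Lemma gtn_trans : transitive gtn.
Proof. exact: rev_trans ltn_trans. Qed.

(** A row of length [x] above the rows [l] has first-column hook length [x + size l]: arm [x - 1],
    leg [size l], and the cell itself. *)
Fixpoint betas (la : seq nat) : seq nat :=
  if la is x :: l then x + size l :: betas l else [::].

Fixpoint unbetas (s : seq nat) : seq nat :=
  if s is y :: s' then y - size s' :: unbetas s' else [::].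

Lemma size_betas la : size (betas la) = size la.
Proof. by elim: la => //= x l ->. Qed.

Lemma size_unbetas s : size (unbetas s) = size s.
Proof. by elim: s => //= x l ->. Qed.

Lemma betasK : cancel betas unbetas.
Proof. by elim=> //= x l IH; rewrite IH size_betas addnK. Qed.

Lemma is_partition_cons x l :
  is_partition (x :: l) = [&& 0 < x, all (geq x) l & is_partition l].
Proof.
rewrite /is_partition /= (path_sortedE geq_trans) in_cons negb_or lt0n eq_sym.
by case: (x != 0); rewrite ?andbF //= andbA.
Qed.

Lemma betas_lt x l : all (geq x) l -> all (gtn (x + size l)) (betas l).
Proof.
elim: l x => //= y l IH x /andP [xy /IH yl]; apply/andP; split; first by lia.
by apply: sub_all yl => u /=; lia.
Qed.

Lemma betas_sorted la : is_partition la -> sorted gtn (betas la) && (0 \notin betas la).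
Proof.
elim: la => //= x l IH; rewrite is_partition_cons => /and3P [x0 xl /IH /andP [sl zl]].
rewrite (path_sortedE gtn_trans) betas_lt // sl in_cons negb_or zl andbT /=; lia.
Qed.

(** The list [y :: s] consists of distinct positive integers up to [y]. This makes the subtraction
    in [unbetas] exact and its result positive. *)
Lemma size_lt_head y s : path gtn y s -> 0 \notin y :: s -> size s < y.
Proof.
elim: s y => [|u s IH] y /=; first by rewrite inE; case: y.
move=> /andP [uy us]; rewrite inE negb_or => /andP [_ /(IH u us)]; lia.
Qed.

Lemma unbetasK s : sorted gtn s -> 0 \notin s -> betas (unbetas s) = s.
Proof.
elim: s => //= y s IH ps zs; have := size_lt_head ps zs => hy.
rewrite IH ?(path_sorted ps) //; last by move: zs; rewrite inE negb_or => /andP [].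
by rewrite size_unbetas subnK //; lia.
Qed.

Lemma unbetas_partition s : sorted gtn s -> 0 \notin s -> is_partition (unbetas s).
Proof.
elim: s => //= y s IH ps zs; have hy := size_lt_head ps zs.
rewrite is_partition_cons IH ?(path_sorted ps) ?andbT //; last first.
  by move: zs; rewrite inE negb_or => /andP [].
(* From one bead to the next the value drops by at least 1 and the subtracted length by exactly 1,
   so the rows do not increase. *)
rewrite subn_gt0 hy /=; clear IH hy; elim: s y ps zs => //= u s IH y /andP [uy ps] zs.
move: zs; rewrite inE negb_or => /andP [_ zs]; have hu := size_lt_head ps zs.
rewrite /=; apply/andP; split; first by rewrite /gtn /= in uy *; lia.
by apply: sub_all (IH u ps zs) => w /=; rewrite /gtn /= in uy; lia.
Qed.

Lemma sumn_betas la : sumn (betas la) = sumn la + 'C(size la, 2).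
Proof. by elim: la => //= x l ->; rewrite binS bin1; lia. Qed.

(** * Hook lengths read off the beta-set *)

Lemma young_diagram_cons x l :
  young_diagram (x :: l) =
  [seq (0, j) | j <- iota 0 x] ++ [seq (c.1.+1, c.2) | c <- young_diagram l].
Proof.
rewrite /young_diagram /= -[in iota 1 _](addn0 1) iotaDl -/(iota 0 _).
congr (_ ++ _); rewrite map_flatten -!map_comp; congr flatten.
by apply: eq_map => i /=; rewrite add1n -map_comp.
Qed.

Lemma hook_length_cons_below x l i j :
  hook_length (x :: l) (i.+1, j) = hook_length l (i, j).
Proof.
rewrite /hook_length young_diagram_cons count_cat !count_map.
rewrite (@eq_count _ _ pred0) ?count_pred0 => [|j']; last first.
  by rewrite /= /in_hook /= !xpair_eqE /= ltn0 andbF.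
by apply: eq_count => -[i' j'] /=; rewrite /in_hook /= !xpair_eqE eqSS ltnS.
Qed.

Lemma count_iota_leq j x : count (leq j) (iota 0 x) = x - j.
Proof. by elim: x => // x IH; rewrite -addn1 iotaD count_cat IH /=; lia. Qed.

Lemma count_column j l :
  count (fun c => c.2 == j) (young_diagram l) = count (ltn j) l.
Proof.
elim: l => // x l IH; rewrite young_diagram_cons count_cat !count_map /= -IH.
congr (_ + _).
rewrite (@eq_count _ _ (pred1 j)) // count_uniq_mem ?iota_uniq // mem_iota /=.
by rewrite add0n.
Qed.

Lemma hook_length_cons_first x l j :
  hook_length (x :: l) (0, j) = (x - j) + count (ltn j) l.
Proof.
rewrite /hook_length young_diagram_cons count_cat !count_map; congr (_ + _).
  rewrite -count_iota_leq; apply: eq_count => j'.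
  by rewrite /= /in_hook /= !xpair_eqE eqxx /= andbF /= orbC [j <= _]leq_eqVlt eq_sym.
rewrite -count_column; apply: eq_count => -[i' j'] /=.
by rewrite /in_hook /= !xpair_eqE /= andbT orbF.
Qed.

(* The complement of the beta-set is enumerated by the columns. *)
Lemma notin_betasP l y : sorted geq l ->
  reflect (exists j, y = j + count (geq j) l) (y \notin betas l).
Proof.
move=> sl; apply: (iffP idP).
  elim: l sl => [|x l IH] /=; first by exists y; rewrite addn0.
  move=> pl; rewrite inE negb_or => /andP [yx /(IH (path_sorted pl)) [j yj]].
  have [jx|xj] := ltnP j x; first by exists j; lia.
  have := order_path_min geq_trans pl => /allP lx.
  have cl i : x <= i -> count (geq i) l = size l.
    move=> xi; apply/eqP; rewrite -all_count; apply/allP => u /lx /=; lia.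
  (* As [y] differs from [x + size l], in fact [x < j]; the first row now also enters the count, so
     the column index goes down by one. *)
  exists j.-1; rewrite cl in yj => //; rewrite cl; lia.
elim: l sl => [|x l IH] //= pl [j yj].
have /allP lx := order_path_min geq_trans pl.
have cl i : x <= i -> count (geq i) l = size l.
  move=> xi; apply/eqP; rewrite -all_count; apply/allP => u /lx /=; lia.
rewrite inE negb_or; have [jx|xj] := ltnP j x.
  have cs := count_size (geq j) l.
  apply/andP; split; first by lia.
  by apply: IH (path_sorted pl) _; exists j; lia.
rewrite cl // in yj; apply/andP; split; first by lia.
by apply: IH (path_sorted pl) _; exists j.+1; rewrite cl; lia.
Qed.

Definition sub_closed (t : nat) (s : seq nat) :=
  all (fun x => (t <= x) ==> (x - t \in s)) s.

(** In the first row, the hook length at column [j] and the gap [j + count (geq j) l] of [betas l]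
    add up to the leading bead [x + size l]. So [t] is a hook length there exactly when the leading
    bead minus [t] is a nonnegative gap. *)
Lemma no_hook_sub_closed t la : 0 < t -> is_partition la ->
  all (fun c => hook_length la c != t) (young_diagram la) = sub_closed t (betas la).
Proof.
move=> t0; elim: la => // x l IH; rewrite is_partition_cons => /and3P [x0 xl pl].
have sl : sorted geq l by case/andP: pl.
have bl := betas_lt xl.
rewrite young_diagram_cons all_cat !all_map /sub_closed /=; congr (_ && _); last first.
  rewrite -[RHS]/(all _ (betas l)).
  transitivity (all (fun c => hook_length l c != t) (young_diagram l)).
    by apply: eq_all => -[i j] /=; rewrite hook_length_cons_below.
  rewrite IH //; apply: eq_in_all => y /(allP bl) /= ylt; rewrite inE.
  by case: (leqP t y) => //= ty; rewrite (_ : _ == _ = false) //; lia.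
rewrite inE (_ : _ == _ = false) /=; last by lia.
have hookE j : x - j + count (ltn j) l + (j + count (geq j) l) = x - j + j + size l.
  rewrite -(count_predC (geq j) l) (@eq_count _ (predC (geq j)) (ltn j)); first by lia.
  by move=> u /=; rewrite ltnNge.
apply/idP/idP => [/allP h | h].
  apply/implyP => tx; apply/negPn/negP => /(notin_betasP _ sl) [j jE].
  have cs := count_size (geq j) l; have hj := hookE j.
  have [jx|xj] := ltnP j x.
    have := h j; rewrite mem_iota => /(_ jx) /=; rewrite hook_length_cons_first; lia.
  (* Beyond the end of the first row every gap is at least the leading bead, whereas this one is
     smaller by [t]. *)
  have cl : count (geq j) l = size l.
    apply/eqP; rewrite -all_count; apply/allP => u /(allP xl) /=; lia.
  lia.
apply/allP => j; rewrite mem_iota add0n => /= jx; rewrite hook_length_cons_first.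
apply/negP => /eqP hj; have hh := hookE j.
have : x + size l - t \notin betas l by apply/(notin_betasP _ sl); exists j; lia.
by move: h; rewrite (_ : t <= _) /= => [->|]; lia.
Qed.

Lemma is_coreE a b la : 0 < a -> 0 < b ->
  is_core a b la =
  [&& is_partition la, sub_closed a (betas la) & sub_closed b (betas la)].
Proof.
move=> a0 b0; rewrite /is_core all_predI.
by case pl: (is_partition la) => //=; rewrite !no_hook_sub_closed.
Qed.

(** * The abacus with [k] runners *)

Lemma sub_closed_iter t s i x :
  sub_closed t s -> x \in s -> i * t <= x -> x - i * t \in s.
Proof.
move=> /allP ts xs; elim: i => [|i IH] hi; first by rewrite subn0.
have /IH/ts : i * t <= x by lia.
by rewrite (_ : t <= _) /= => [h|]; first rewrite mulSn addnC subnDA //; lia.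
Qed.

(* [L] only has to bound the number of beads [n j] on each runner. *)
Definition abacus (k L : nat) (n : nat -> nat) : seq nat :=
  rev [seq x <- iota 0 (L * k) | x %/ k < n (x %% k)].

Lemma mem_abacus k L n x : 0 < k -> (forall j, j < k -> n j <= L) ->
  (x \in abacus k L n) = (x %/ k < n (x %% k)).
Proof.
move=> k0 nL; rewrite mem_rev mem_filter mem_iota add0n /= andb_idr // => h.
have := nL _ (ltn_pmod x k0) => h'; rewrite -ltn_divLR //; lia.
Qed.

Lemma abacus_sorted k L n : sorted gtn (abacus k L n).
Proof.
rewrite rev_sorted; apply: (sorted_filter ltn_trans); exact: iota_ltn_sorted.
Qed.

Lemma sum_abacus k L n (f : nat -> nat) : 0 < k -> (forall j, j < k -> n j <= L) ->
  \sum_(x <- abacus k L n) f x = \sum_(j < k) \sum_(q < n j) f (q * k + j).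
Proof.
move=> k0 nL; rewrite (perm_big _ (permEl (perm_rev _))) big_filter -/(index_iota 0 _).
rewrite -{1}[L * k]subn0 -/(index_iota 0 (L * k)) big_mkcond big_nat_mul big_mkord.
transitivity (\sum_(q < L) \sum_(j < k) if q < n j then f (q * k + j) else 0).
  apply: eq_bigr => q _; rewrite -{1}[q * k]add0n [q.+1 * k]mulSn big_addn addnK big_mkord.
  by apply: eq_bigr => j _; rewrite addnC divnMDl // modnMDl modn_small // divn_small // addn0.
rewrite exchange_big /=; apply: eq_bigr => j _.
rewrite (big_ord_widen L (fun q => f (q * k + j)) (nL _ (ltn_ord j))).
by rewrite [RHS]big_mkcond.
Qed.

Definition runner_length (k : nat) (s : seq nat) (j : nat) : nat :=
  \max_(x <- s | x %% k == j) (x %/ k).+1.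

(** Repeated subtraction of [k] from the top bead of a runner fills all places below it, so the
    maximum in [runner_length] also counts the beads. *)
Lemma lt_runner_length k s j q : sub_closed k s -> j < k ->
  (q < runner_length k s j) = (q * k + j \in s).
Proof.
move=> ks jk; have k0 : 0 < k by lia.
apply/idP/idP => [|h]; last first.
  have := @leq_bigmax_seq _ s (fun x => x %% k == j) (fun x => (x %/ k).+1) _ h.
  by rewrite modnMDl modn_small // eqxx divnMDl // divn_small // addn0 => /(_ isT).
apply: contraLR => h; rewrite -leqNgt; apply/bigmax_leqP_seq => x xs /eqP xj.
rewrite ltnNge; apply/negP => qx; move/negP: h; apply.
have xE := divn_eq x k; rewrite xj in xE.
have := @sub_closed_iter k s (x %/ k - q) x ks xs.
rewrite mulnBl (_ : x - _ = q * k + j); first by apply; lia.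
have : q * k <= x %/ k * k by rewrite leq_mul2r qx orbT.
lia.
Qed.

(** * Weak compositions and the ballot condition *)

Section Compositions.

Variables k b : nat.

Implicit Types z : k.-tuple 'I_b.+1.

Definition psum z (j : nat) : nat := \sum_(i < k | i < j) tnth z i.

(** Taking the parts in ['I_b.+1] excludes no weak composition of [b] and makes the type finite. *)
Definition composition z : bool := \sum_(i < k) tnth z i == b.

Definition ballot z : bool := [forall j : 'I_k, psum z j * k <= j * b].

Lemma psum0 z : psum z 0 = 0.
Proof. by rewrite /psum big_pred0. Qed.

Lemma psumS z (j : 'I_k) : psum z j.+1 = psum z j + tnth z j.
Proof.
rewrite /psum (bigD1 j) //= addnC; congr (_ + _); apply: eq_bigl => i.
by rewrite -val_eqE /= ltnS [RHS]ltn_neqAle andbC.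
Qed.

Lemma psum_full z : psum z k = \sum_(i < k) tnth z i.
Proof. by apply: eq_bigl => i; rewrite ltn_ord. Qed.

Lemma psum_mono z i j : i <= j -> psum z i <= psum z j.
Proof.
move=> ij; rewrite /psum big_mkcond [X in _ <= X]big_mkcond; apply: leq_sum => u _.
by case: (ltnP u i) => // ui; rewrite (leq_trans ui ij).
Qed.

Lemma psum_inj z1 z2 : (forall j, j <= k -> psum z1 j = psum z2 j) -> z1 = z2.
Proof.
move=> h; apply: eq_from_tnth => j; apply: val_inj => /=.
have := h _ (ltn_ord j); rewrite !psumS (h j); first by move/addnI.
exact: ltnW.
Qed.

End Compositions.

(** * The bijection between ballot compositions and cores *)

Section CoreOfBallot.

Variables (k' m : nat).
Let k := k'.+1.
Let b := m * k + 1.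

Implicit Types z : k.-tuple 'I_b.+1.

(** The bead count of runner [j], found by telescoping the steps. For ballot [z] and [j < k] the
    subtraction is exact, by [ballotP]. *)
Definition beads z (j : nat) : nat := j * m - psum z j.

Definition core_of z : seq nat := unbetas (abacus k (k * m) (beads z)).

(** As [b = m * k + 1], the bound [j * b] is [j * m * k + j], and the remainder [j < k] leaves no
    room for one more multiple of [k]. *)
Lemma ballotP z : reflect (forall j, j < k -> psum z j <= j * m) (ballot z).
Proof.
have E j : j < k -> (psum z j * k <= j * b) = (psum z j <= j * m).
  move: (psum z j) => p jk; rewrite /b mulnDr muln1 mulnA; have [h|h] := leqP p (j * m).
    by rewrite (leq_trans _ (leq_addr _ _)) // leq_mul2r h orbT.
  have : (j * m).+1 * k <= p * k by rewrite leq_mul2r h orbT.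
  by rewrite mulSn; lia.
apply: (iffP forallP) => [h j jk|h j]; last by rewrite E // h.
by rewrite -E //; exact: (h (Ordinal jk)).
Qed.

Lemma beads_bound z j : j < k -> beads z j <= k * m.
Proof. by move=> jk; rewrite /beads (leq_trans (leq_subr _ _)) // leq_mul2r ltnW ?orbT. Qed.

Lemma mem_core_of z x : (x \in abacus k (k * m) (beads z)) = (x %/ k < beads z (x %% k)).
Proof. by apply: mem_abacus => // j; apply: beads_bound. Qed.

Lemma betas_core_of z : betas (core_of z) = abacus k (k * m) (beads z).
Proof.
rewrite unbetasK ?abacus_sorted // mem_core_of.
by rewrite mod0n div0n /beads psum0.
Qed.

Lemma core_of_is_core z : composition z -> ballot z -> is_core k b (core_of z).
Proof.
move=> cz /ballotP bz; have b0 : 0 < b by rewrite /b addn1.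
rewrite is_coreE // betas_core_of; apply/and3P; split.
- apply: unbetas_partition; first exact: abacus_sorted.
  by rewrite mem_core_of mod0n div0n /beads psum0.
- apply/allP => x; rewrite mem_core_of => hx; apply/implyP => kx; rewrite mem_core_of.
  have xE : x = k + (x - k) by lia.
  move: hx; rewrite {1 2}xE divnDl // modnDl divnn /=; lia.
- apply/allP => x; rewrite mem_core_of => hx; apply/implyP => bx; rewrite mem_core_of.
  have xE := divn_eq x k; have xk : x %% k < k by rewrite ltn_pmod.
  (* Subtracting [b] takes a bead from runner [j + 1] to runner [j], [m] places lower; nothing wraps
     around, since runner 0 is empty. *)
  case E: (x %% k) => [|j]; first by move: hx; rewrite E /beads.
  rewrite E in hx xE xk.
  have mq : m <= x %/ k.
    by rewrite leq_divRL // (leq_trans _ bx) // /b leq_addr.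
  have mkq : m * k <= x %/ k * k by rewrite leq_mul2r mq orbT.
  have -> : x - b = (x %/ k - m) * k + j by rewrite mulnBl /b; lia.
  have jk : j < k by lia.
  rewrite divnMDl // modnMDl modn_small // (divn_small jk) addn0.
  move: hx; rewrite /beads mulSn.
  have := psum_mono z (leqnSn j); have := bz j jk; lia.
Qed.

Lemma core_of_inj : {in [pred z | composition z && ballot z] &, injective core_of}.
Proof.
move=> z1 z2 /andP [/eqP c1 /ballotP b1] /andP [/eqP c2 /ballotP b2] e.
have memE x : (x %/ k < beads z1 (x %% k)) = (x %/ k < beads z2 (x %% k)).
  by rewrite -!mem_core_of -!betas_core_of e.
(* The beads only see the partial sums with [j < k]; the last one is the total [b]. *)
apply: psum_inj => j; rewrite leq_eqVlt => /orP [/eqP ->|jk]; first by rewrite !psum_full c1.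
have bE q : (q < beads z1 j) = (q < beads z2 j).
  by have := memE (q * k + j); rewrite divnMDl // modnMDl modn_small // (divn_small jk) addn0.
have := b1 j jk; have := b2 j jk; have := bE (beads z1 j); have := bE (beads z2 j).
rewrite /beads; lia.
Qed.

Lemma core_of_surj la : is_core k b la ->
  exists2 z, composition z && ballot z & core_of z = la.
Proof.
have b0 : 0 < b by rewrite /b addn1.
rewrite is_coreE // => /and3P [pl ck cb]; set s := betas la in ck cb.
have /andP [ss s0] := betas_sorted pl.
pose n := runner_length k s.
have nE q j : j < k -> (q < n j) = (q * k + j \in s) by exact: lt_runner_length.
have n0 : n 0 = 0 by apply/eqP; rewrite -leqn0 leqNgt nE.
(* A bead at place [n j + m] of runner [j + 1] would, on subtracting [b], give a bead at place [n j]
   of runner [j], which is the first empty one. *)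
have nS j : j.+1 < k -> n j.+1 <= n j + m.
  move=> jk; rewrite leqNgt nE //; apply/negP => h.
  have := allP cb _ h; rewrite (_ : b <= _) /=; last by rewrite mulnDl /b; lia.
  rewrite (_ : _ - b = n j * k + j); last by rewrite mulnDl /b; lia.
  by rewrite -nE ?ltnn; lia.
have nle j : j < k -> n j <= j * m.
  by elim: j => [|j IH] jk; [rewrite n0 | have := nS j jk; have := IH (ltnW jk); lia].
pose f i := if i.+1 < k then n i + m - n i.+1 else n i + m + 1.
have fb i : i < k -> f i <= b.
  move=> ik; have h := nle i ik.
  have : i.+1 * m <= m * k by rewrite mulnC leq_mul2l ik orbT.
  by rewrite /f /b; case: ifP => _; lia.
pose z : k.-tuple 'I_b.+1 := [tuple inord (f i) | i < k].
have zE (i : 'I_k) : tnth z i = f i :> nat by rewrite tnth_mktuple inordK // ltnS fb.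
have pE j : j < k -> psum z j + n j = j * m.
  elim: j => [|j IH] jk; first by rewrite psum0 n0.
  have := IH (ltnW jk); have := nS j jk.
  by rewrite (psumS z (Ordinal (ltnW jk))) zE /f /= jk; lia.
have bE j : j < k -> beads z j = n j by move=> jk; rewrite /beads -pE // addKn.
exists z.
  apply/andP; split; last by apply/ballotP => j jk; have := pE j jk; lia.
  rewrite /composition -psum_full; apply/eqP.
  rewrite (psumS z ord_max) zE /f /= ltnn.
  by have := pE k' (ltnSn _); rewrite /b /k; lia.
rewrite -[la]betasK -/s /core_of; congr unbetas.
apply: (irr_sorted_eq gtn_trans) => [u|||x] //; [exact: ltnn | exact: abacus_sorted |].
have xk : x %% k < k by rewrite ltn_pmod.
by rewrite mem_core_of bE // nE // -divn_eq.
Qed.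

(** The sum of all beads is taken once by [sumn_betas] and once runner by runner. *)
Lemma psize_core_of z :
  psize (core_of z) + 'C(\sum_(j < k) beads z j, 2) =
  \sum_(j < k) \sum_(q < beads z j) (q * k + j).
Proof.
have bb j (jk : j < k) := beads_bound z jk.
rewrite -(@sum_abacus k (k * m) _ id) // -betas_core_of -sumnE sumn_betas /psize.
congr (_ + 'C(_, 2)); rewrite -size_betas betas_core_of -sum1_size sum_abacus //.
by apply: eq_bigr => j _; rewrite sum1_card card_ord.
Qed.

End CoreOfBallot.

Local Open Scope ring_scope.

(** * Cyclic rotation and the cycle lemma *)

Section Rotation.

Variables (k' b : nat).
Let k := k'.+1.

Implicit Types (z : k.-tuple 'I_b.+1) (i j s t : 'I_k).

Definition rotate s z : k.-tuple 'I_b.+1 := [tuple tnth z (i + s) | i < k].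

Lemma tnth_rotate s z i : tnth (rotate s z) i = tnth z (i + s).
Proof. exact: tnth_mktuple. Qed.

Lemma rotate_rotate s t z : rotate s (rotate t z) = rotate (s + t) z.
Proof. by apply: eq_from_tnth => i; rewrite !tnth_rotate addrA. Qed.

Lemma rotateK s : cancel (rotate s) (rotate (- s)).
Proof.
by move=> z; rewrite rotate_rotate addNr; apply: eq_from_tnth => i; rewrite tnth_rotate addr0.
Qed.

Lemma rotate_bij s : bijective (rotate s).
Proof. by exists (rotate (- s)); [|rewrite -{2}[s]opprK]; exact: rotateK. Qed.

Lemma composition_rotate s z : composition (rotate s z) = composition z.
Proof.
rewrite /composition [in RHS](reindex_inj (addIr s)) /=; congr (_ == _).
by apply: eq_bigr => i _; rewrite tnth_rotate.
Qed.

Lemma sum_composition_rotate (R : nmodType) s (f : k.-tuple 'I_b.+1 -> R) :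
  \sum_(z | composition z) f (rotate s z) = \sum_(z | composition z) f z.
Proof.
rewrite [RHS](reindex (rotate s)) /=; last exact/onW_bij/rotate_bij.
by apply: eq_bigl => z; rewrite composition_rotate.
Qed.

(** This is [k] times the signed distance by which the path of partial sums lies below the line of
    slope [b / k]. *)
Definition height z (j : nat) : int := (j * b)%:Z - (k * psum z j)%:Z.

Lemma height0 z : height z 0 = 0.
Proof. by rewrite /height psum0 muln0. Qed.

(** Adding [one] is the cyclic successor; for [k = 1] it is 0. *)
Let one : 'I_k := inZp 1.

(** The step also holds across the end: the parts add up to [b], so the height returns to 0 at index
    [k]. *)
Lemma height_step z j : composition z ->
  height z (j + one)%R = height z j + b%:Z - (k * tnth z j)%:Z.
Proof.
move=> /eqP cz; rewrite /= modnDmr addn1.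
have [jk|kj] := ltnP j.+1 k; first by rewrite modn_small // /height psumS mulSn mulnDr !PoszD; ring.
have jE : j.+1 = k by apply/eqP; rewrite eqn_leq ltn_ord kj.
rewrite jE modnn height0 /height; have := psumS z j; rewrite jE psum_full cz => e.
have : (k * b = k * psum z j + k * tnth z j)%N by rewrite -mulnDr -e.
by rewrite -{1}jE mulSn; lia.
Qed.

(** The path of heights is closed, and rotation restarts it at [s]. *)
Lemma height_rotate s z j : composition z ->
  height (rotate s z) j = height z (j + s)%R - height z s.
Proof.
move=> cz.
case: j => n; elim: n => [|n IH] nk.
  have -> : Ordinal nk = 0 by apply: val_inj.
  by rewrite add0r subrr height0.
have nk' := ltnW nk.
have -> : Ordinal nk = Ordinal nk' + one.
  by apply: val_inj; rewrite /= modnDmr addn1 modn_small.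
rewrite height_step ?composition_rotate // IH [_ + one + s]addrAC height_step //.
by rewrite tnth_rotate; ring.
Qed.

Lemma ballot_height z : ballot z = [forall j : 'I_k, 0 <= height z j].
Proof. by apply: eq_forallb => j; rewrite /height; lia. Qed.

Lemma ballot_rotate s z : composition z ->
  ballot (rotate s z) = [forall j : 'I_k, height z s <= height z j].
Proof.
move=> cz; rewrite ballot_height; apply/forallP/forallP => h j.
  by have := h (j - s); rewrite height_rotate // subrK subr_ge0.
by rewrite height_rotate // subr_ge0.
Qed.

Hypothesis coprime_bk : coprime k b.

(** The height at [j] is congruent to [j * b] modulo [k], and [b] is invertible modulo [k]. *)
Lemma height_inj z i j : height z i = height z j -> i = j.
Proof.
move=> h; apply: val_inj => /=.
have := ltn_ord i; have := ltn_ord j.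
have : (i * b = j * b %[mod k])%N.
  apply/eqP; rewrite -[X in X == _](modnMDl (psum z j)) -[X in _ == X](modnMDl (psum z i)).
  by apply/eqP; congr (_ %% _)%N; move: h; rewrite /height; lia.
wlog ij : i j h / (i <= j)%N.
  by move=> w; case/orP: (leq_total i j) => ij e h1 h2; [|symmetry]; apply: w.
move/eqP; rewrite eq_sym eqn_mod_dvd ?leq_mul2r ?ij ?orbT // -mulnBl Gauss_dvdl //.
move=> /dvdnP [[|q] qE] jk ik; first by lia.
move: qE; rewrite mulSn; lia.
Qed.

(* The cycle lemma: only the rotation starting at the lowest point is ballot. *)
Lemma cycle_lemma z : composition z -> #|[set s | ballot (rotate s z)]| = 1%N.
Proof.
move=> cz; apply/eqP/cards1P.
case: (@arg_minP _ _ _ (0 : 'I_k) xpredT (fun s => height z s) isT) => s _ smin.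
exists s; apply/setP => t; rewrite !inE ballot_rotate //.
apply/forallP/eqP => [tmin|-> j]; last exact: smin.
by apply: (@height_inj z); apply/eqP; rewrite eq_le tmin smin.
Qed.

(** Double counting of the pairs [(s, z)] with [rotate s z] ballot, weighted by [F z]: each shift
    reproduces the ballot sum, and each [z] has one such shift by [cycle_lemma]. *)
Lemma sum_ballot (F : k.-tuple 'I_b.+1 -> rat) :
  (forall s z, F (rotate s z) = F z) ->
  k%:R * \sum_(z | composition z && ballot z) F z = \sum_(z | composition z) F z.
Proof.
move=> FE; rewrite big_mkcondr /=.
transitivity (\sum_(s < k) \sum_(z | composition z)
    (if ballot (rotate s z) then F z else 0)).
  set A := \sum_(z | _) _; rewrite mulr_natl.
  transitivity (\sum_(s < k) A); first by rewrite sumr_const card_ord.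
  apply: eq_bigr => s _; rewrite /A -(sum_composition_rotate s) /=.
  by apply: eq_bigr => z _; rewrite FE.
rewrite exchange_big /=; apply: eq_bigr => z cz.
rewrite -big_mkcond sumr_const -[RHS]mulr1n; congr (_ *+ _).
by rewrite -(cycle_lemma cz); apply: eq_card => s; rewrite !inE.
Qed.

End Rotation.

(** * Moments of the parts of a random weak composition *)

Section Moments.

Variables (k' b : nat).
Local Notation k := k'.+1.
Local Notation T := (k.-tuple 'I_b.+1).

Implicit Types (z : T) (i j l s : 'I_k).

Definition transfer i j z : T :=
  [tuple if l == i then inord (tnth z i).-1
         else if l == j then inord (tnth z j).+1 else tnth z l | l < k].

Lemma composition_split z i j : i != j ->
  (\sum_(l < k) tnth z l = tnth z i + (tnth z j + \sum_(l < k | (l != i) && (l != j)) tnth z l))%N.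
Proof. by move=> ij; rewrite (bigD1 i) //= (bigD1 j) 1?eq_sym. Qed.

Lemma transfer_composition i j z : i != j -> composition z -> (0 < tnth z i)%N ->
  [/\ composition (transfer i j z), tnth (transfer i j z) i = (tnth z i).-1 :> nat,
      tnth (transfer i j z) j = (tnth z j).+1 :> nat & transfer j i (transfer i j z) = z].
Proof.
move=> ij cz zi; have := cz; rewrite /composition (composition_split z ij) => /eqP zE.
(* A positive part [i] leaves at most [b - 1] for part [j], whose successor thus still fits in
   ['I_b.+1]. *)
have lt_b (p q r : nat) : (p + (q + r) = b -> 0 < p -> q < b)%N by lia.
have wi : tnth (transfer i j z) i = (tnth z i).-1 :> nat.
  by rewrite tnth_mktuple eqxx inordK // (leq_ltn_trans (leq_pred _) (ltn_ord _)).
have wj : tnth (transfer i j z) j = (tnth z j).+1 :> nat.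
  by rewrite tnth_mktuple eq_sym (negbTE ij) eqxx inordK // ltnS; apply: lt_b zE zi.
split=> //.
  rewrite /composition (composition_split _ ij) wi wj.
  rewrite (eq_bigr (fun l => tnth z l : nat)); first by rewrite addSn -addSnnS prednK // zE.
  by move=> l /andP [li lj]; rewrite tnth_mktuple (negbTE li) (negbTE lj).
apply: eq_from_tnth => l; apply: val_inj; rewrite /= tnth_mktuple.
case: eqP => [->|/eqP lj]; first by rewrite wj /= inord_val.
case: eqP => [->|/eqP li]; first by rewrite wi prednK // inord_val.
by rewrite tnth_mktuple (negbTE li) (negbTE lj).
Qed.

(** Between the compositions with part [i] positive and those with part [j] positive, [transfer i j]
    is a bijection with inverse [transfer j i]. *)
Lemma sum_transfer (F : nat -> nat -> rat) i j : i != j ->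
  \sum_(z : T | composition z && (0 < tnth z i)%N) F (tnth z i).-1 (tnth z j).+1 =
  \sum_(z : T | composition z && (0 < tnth z j)%N) F (tnth z i) (tnth z j).
Proof.
move=> ij; have ji : j != i by rewrite eq_sym.
rewrite [RHS](reindex_onto (transfer i j) (transfer j i)) /=; last first.
  by move=> z /andP [cz zj]; case: (transfer_composition ji cz zj).
apply: eq_big => [z|z /andP [cz zi]]; last first.
  by case: (transfer_composition ij cz zi) => _ -> -> _.
apply/andP/andP => [[cz zi]|[/andP [cw wj] /eqP <-]].
  by case: (transfer_composition ij cz zi) => -> _ -> ->; rewrite eqxx.
by case: (transfer_composition ji cw wj) => -> _ -> _.
Qed.

Notation part z i := ((nat_of_ord (tnth z i))%:R : rat).

Let N : rat := \sum_(z : T | composition z) 1.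

Lemma card_compositions : N = 'C(k' + b, k')%:R.
Proof.
rewrite /N sumr_const -card_ord_partitions; congr (_%:R); apply: eq_card => z.
by rewrite !inE /composition big_tuple.
Qed.

Lemma natr_composition z : composition z -> \sum_(i < k) part z i = b%:R.
Proof. by move=> /eqP cz; rewrite -natr_sum cz. Qed.

(** By rotation all parts have the same total, and together they give [b] for each composition. *)
Lemma first_moment i : \sum_(z : T | composition z) part z i = b%:R * N / k%:R.
Proof.
have E l : \sum_(z : T | composition z) part z l = \sum_(z : T | composition z) part z 0.
  rewrite -(sum_composition_rotate l (fun z => part z 0)).
  by apply: eq_bigr => z _; rewrite tnth_rotate add0r.
have : \sum_(l < k) \sum_(z : T | composition z) part z l = b%:R * N.
  rewrite exchange_big mulr_sumr; apply: eq_bigr => z cz.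
  by rewrite natr_composition // mulr1.
rewrite (eq_bigr _ (fun l _ => E l)) sumr_const card_ord E => <-.
by rewrite -[X in _ = X / _]mulr_natr mulfK // pnatr_eq0.
Qed.

(* Moving one unit from part [i] to part [j] matches the terms of the two cubic
   sums; their cubic parts agree, which leaves a relation between quadratic
   moments. *)
Lemma second_moment_relation i j : i != j ->
  \sum_(z : T | composition z) part z i ^+ 2 =
  2 * (\sum_(z : T | composition z) part z i * part z j) + \sum_(z : T | composition z) part z i.
Proof.
move=> ij; have := @sum_transfer (fun p q => p.+1%:R ^+ 2 * q%:R) i j ij.
rewrite !big_mkcondr /=.
have -> : \sum_(z : T | composition z)
    (if (0 < tnth z i)%N then (tnth z i).-1.+1%:R ^+ 2 * (tnth z j).+1%:R else 0) =
  \sum_(z : T | composition z) (part z i ^+ 2 * part z j + part z i ^+ 2).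
  apply: eq_bigr => z _; case: posnP => [->|h]; first by rewrite !expr0n !mul0r addr0.
  by rewrite prednK // -natr1 mulrDr mulr1.
have -> : \sum_(z : T | composition z)
    (if (0 < tnth z j)%N then (tnth z i).+1%:R ^+ 2 * part z j else 0) =
  \sum_(z : T | composition z) (part z i ^+ 2 * part z j + 2 * (part z i * part z j) + part z j).
  apply: eq_bigr => z _; case: posnP => [->|h]; first by rewrite !mulr0 !addr0.
  by rewrite -natr1; ring.
by rewrite !big_split /= -addrA => /addrI ->; rewrite mulr_sumr !first_moment.
Qed.

(** Off-diagonal moments are expressed through the square moment [A] by [second_moment_relation];
    summing over one index, with total [b], gives a linear equation for [A]. *)
Lemma second_moment i j :
  \sum_(z : T | composition z) part z i * part z j =
  b%:R * N / k%:R * ((b%:R - 1) / (k%:R + 1) + (i == j)%:R * ((b%:R - 1) / (k%:R + 1) + 1)).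
Proof.
pose A := \sum_(z : T | composition z) part z i ^+ 2.
have offdiag l : l != i -> \sum_(z : T | composition z) part z i * part z l =
    (A - b%:R * N / k%:R) / 2.
  rewrite eq_sym => il; rewrite /A (second_moment_relation il) first_moment.
  by move: (b%:R * N / _) => c; field.
have : \sum_(l < k) \sum_(z : T | composition z) part z i * part z l = b%:R * (b%:R * N / k%:R).
  rewrite exchange_big -(first_moment i) mulr_sumr; apply: eq_bigr => z cz.
  by rewrite -mulr_sumr natr_composition // mulrC.
rewrite (bigD1 i) //= (eq_bigr _ offdiag) sumr_const.
have -> : #|[pred l : 'I_k | l != i]| = k' by rewrite cardC1 card_ord.
have -> : \sum_(z : T | composition z) part z i * part z i = A.
  by apply: eq_bigr => z _; rewrite expr2.
have kE : k%:R = k'%:R + 1 :> rat by rewrite -natr1.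
have k0 : 0 <= k'%:R :> rat by rewrite ler0n.
rewrite -[X in _ + X = _]mulr_natr kE => AE.
have {}AE : A = (2 * b%:R + k'%:R) / (k'%:R + 2) * (b%:R * N / (k'%:R + 1)).
  have h : k'%:R + 2 != 0 :> rat by lra.
  move: (b%:R * N / _) AE => c AE.
  have {}AE : A * (k'%:R + 2) = (2 * b%:R + k'%:R) * c by lra.
  by rewrite mulrAC -AE mulfK.
case: eqP => [<-|/eqP ij] /=; last rewrite offdiag 1?eq_sym // ?kE AE; last first.
  by field; apply/andP; split; lra.
transitivity A; first by apply: eq_bigr => z _; rewrite expr2.
by rewrite AE; field; apply/andP; split; lra.
Qed.

Lemma sum_const_below (c : rat) (j : nat) : (j <= k)%N -> \sum_(i < k | (i < j)%N) c = j%:R * c.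
Proof.
by move=> jk; rewrite -(big_ord_widen k (fun _ => c) jk) sumr_const card_ord mulr_natl.
Qed.

Lemma height_second_moment (j : nat) : (j <= k)%N ->
  \sum_(z : T | composition z) ((height z j)%:~R : rat) ^+ 2 =
  j%:R * (k%:R - j%:R) * (b%:R * (b%:R + k%:R)) / (k%:R + 1) * N.
Proof.
move=> jk; pose S z : rat := \sum_(i < k | (i < j)%N) part z i.
have S1 : \sum_(z : T | composition z) S z = j%:R * (b%:R * N / k%:R).
  by rewrite exchange_big -sum_const_below //; apply: eq_bigr => i _; rewrite first_moment.
set M11 := b%:R * N / k%:R * ((b%:R - 1) / (k%:R + 1)).
set M := b%:R * N / k%:R * ((b%:R - 1) / (k%:R + 1) + 1).
(* All [j ^ 2] pairs of indices below [j] contribute [M11], and the [j] diagonal ones contribute [M]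
   in addition. *)
have S2 : \sum_(z : T | composition z) S z ^+ 2 = j%:R * (j%:R * M11 + M).
  transitivity (\sum_(i < k | (i < j)%N) \sum_(l < k | (l < j)%N)
      \sum_(z : T | composition z) part z i * part z l).
    under [RHS]eq_bigr => i _ do rewrite exchange_big.
    rewrite exchange_big; apply: eq_bigr => z _; rewrite expr2 {1}/S mulr_suml.
    by apply: eq_bigr => i _; rewrite mulr_sumr.
  rewrite -[RHS]sum_const_below //; apply: eq_bigr => i ij.
  rewrite -sum_const_below //.
  transitivity (\sum_(l < k | (l < j)%N) (M11 + (i == l)%:R * M)).
    by apply: eq_bigr => l _; rewrite second_moment /M11 /M; ring.
  rewrite big_split /=; congr (_ + _); rewrite (bigD1 i) //= eqxx mul1r big1 ?addr0 //.
  by move=> l /andP [_ li]; rewrite eq_sym (negbTE li) mul0r.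
transitivity (\sum_(z : T | composition z)
    ((j%:R * b%:R) ^+ 2 * 1 - 2 * j%:R * b%:R * k%:R * S z + k%:R ^+ 2 * S z ^+ 2)).
  apply: eq_bigr => z _.
  have -> : (height z j)%:~R = j%:R * b%:R - k%:R * S z :> rat.
    by rewrite /height rmorphB /= -!pmulrn !natrM natr_sum.
  ring.
rewrite !big_split /= sumrN -!mulr_sumr -/N S1 S2 /M11 /M.
have k0 : 0 <= k'%:R :> rat by rewrite ler0n.
have -> : k%:R = k'%:R + 1 :> rat by rewrite -natr1.
by field; apply/andP; split; lra.
Qed.

End Moments.

(** * The size of a core as a quadratic form in the heights *)

Lemma sum_natr (n : nat) : \sum_(j < n) (j%:R : rat) = n%:R * (n%:R - 1) / 2.
Proof. by elim: n => [|n IH]; rewrite ?big_ord0 ?big_ord_recr /= ?IH -?natr1; field. Qed.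

Lemma sum_natr_sqr (n : nat) :
  \sum_(j < n) (j%:R ^+ 2 : rat) = n%:R * (n%:R - 1) * (2 * n%:R - 1) / 6.
Proof. by elim: n => [|n IH]; rewrite ?big_ord0 ?big_ord_recr /= ?IH -?natr1; field. Qed.

Lemma natr_bin2 (n : nat) : 'C(n, 2)%:R = n%:R * (n%:R - 1) / 2 :> rat.
Proof.
elim: n => [|n IH]; first by rewrite !mul0r.
by rewrite binS bin1 natrD IH -natr1; field.
Qed.

Lemma sum_pair_sqr_diff (n : nat) (x : 'I_n -> rat) :
  \sum_s \sum_j (x j - x s) ^+ 2 = 2 * n%:R * (\sum_j x j ^+ 2) - 2 * (\sum_j x j) ^+ 2.
Proof.
set Q := \sum_j x j ^+ 2; set X := \sum_j x j.
have E s : \sum_j (x j - x s) ^+ 2 = Q - 2 * X * x s + n%:R * x s ^+ 2.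
  transitivity (\sum_j (x j ^+ 2 - 2 * x s * x j + x s ^+ 2)).
    by apply: eq_bigr => j _; ring.
  rewrite !big_split /= sumr_const card_ord sumrN -mulr_sumr -/Q -/X -mulr_natl; ring.
rewrite (eq_bigr _ (fun s _ => E s)) !big_split /= sumr_const card_ord sumrN -!mulr_sumr -/Q -/X.
by rewrite -mulr_natl; ring.
Qed.

Section SizeFormula.

Variables (k' b : nat).
Local Notation k := k'.+1.
Local Notation T := (k.-tuple 'I_b.+1).

Implicit Types (z : T) (s : 'I_k).

(** For a composition this is the sum of the squared height differences over ordered pairs. Writing
    it over rotations makes its invariance immediate and reduces its total to second moments of
    single heights. *)
Definition energy z : rat :=
  \sum_(s < k) \sum_(j < k) (height (rotate s z) j)%:~R ^+ 2.

Lemma energy_rotate s z : energy (rotate s z) = energy z.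
Proof.
rewrite /energy [RHS](reindex_inj (addIr s)) /=.
by apply: eq_bigr => t _; rewrite rotate_rotate.
Qed.

Lemma energyE z : composition z ->
  energy z = 2 * k%:R * (\sum_(j < k) (height z j)%:~R ^+ 2)
             - 2 * (\sum_(j < k) (height z j)%:~R) ^+ 2.
Proof.
move=> cz; rewrite -sum_pair_sqr_diff; apply: eq_bigr => s _.
rewrite [RHS](reindex_inj (addIr s)) /=; apply: eq_bigr => j _.
by rewrite height_rotate // rmorphB.
Qed.

Lemma sum_energy :
  \sum_(z : T | composition z) energy z =
  b%:R * (b%:R + k%:R) * k%:R ^+ 2 * (k%:R - 1) / 6 * 'C(k' + b, k')%:R.
Proof.
rewrite exchange_big /=.
rewrite (eq_bigr (fun=> \sum_(j < k) \sum_(z : T | composition z) ((height z j)%:~R : rat) ^+ 2)).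
  rewrite sumr_const card_ord.
  have -> : \sum_(j < k) \sum_(z : T | composition z) ((height z j)%:~R : rat) ^+ 2 =
      (b%:R * (b%:R + k%:R)) / (k%:R + 1) * 'C(k' + b, k')%:R *
      (\sum_(j < k) (k%:R * j%:R - j%:R ^+ 2)).
    rewrite mulr_sumr; apply: eq_bigr => j _; rewrite height_second_moment 1?ltnW //.
    by rewrite card_compositions; ring.
  rewrite big_split /= sumrN -mulr_sumr sum_natr sum_natr_sqr -mulr_natl.
  have k0 : 0 <= k'%:R :> rat by rewrite ler0n.
  have -> : k%:R = k'%:R + 1 :> rat by rewrite -natr1.
  by field; lra.
move=> s _; rewrite [RHS]exchange_big /=.
exact: (sum_composition_rotate s (fun z : T => \sum_(j < k) ((height z j)%:~R : rat) ^+ 2)).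
Qed.

End SizeFormula.

(** For ballot [z] the height at [j] is [j + k * n j], so both sides are polynomials in the sums
    [A], [B], [C]. The subtracted constant is the energy term of the empty core, whose heights are
    0, ..., k - 1. *)
Lemma psize_core_of_energy (k' m : nat) (z : k'.+1.-tuple 'I_(m * k'.+1 + 1).+1) :
  composition z -> ballot z ->
  (psize (core_of z))%:R =
  energy z / (4 * k'.+1%:R ^+ 2) - (k'.+1%:R ^+ 2 - 1) / 24 :> rat.
Proof.
move=> cz /ballotP bz; have := psize_core_of z.
rewrite energyE //; set k := k'.+1 in z cz bz *; set n := beads z.
have hE (j : 'I_k) : (height z j)%:~R = j%:R + k%:R * (n j)%:R :> rat.
  have -> : height z j = (j + k * n j)%N.
    rewrite /height /n /beads mulnBr; have h := bz j (ltn_ord j).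
    have h' : (k * psum z j <= k * (j * m))%N by rewrite leq_mul2l h orbT.
    have -> : (j * (m * k + 1) = k * (j * m) + j)%N by ring.
    by move: h'; move: (k * psum z j)%N (k * (j * m))%N => p q; lia.
  by rewrite -pmulrn natrD natrM.
pose A : rat := \sum_(j < k) (n j)%:R.
pose B : rat := \sum_(j < k) j%:R * (n j)%:R.
pose C : rat := \sum_(j < k) (n j)%:R ^+ 2.
have -> : \sum_(j < k) (height z j)%:~R = k%:R * (k%:R - 1) / 2 + k%:R * A :> rat.
  by rewrite (eq_bigr _ (fun j _ => hE j)) big_split /= sum_natr -mulr_sumr.
have -> : \sum_(j < k) (height z j)%:~R ^+ 2 =
    k%:R * (k%:R - 1) * (2 * k%:R - 1) / 6 + 2 * k%:R * B + k%:R ^+ 2 * C :> rat.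
  rewrite -sum_natr_sqr !mulr_sumr -!big_split /=; apply: eq_bigr => j _.
  by rewrite hE; ring.
move=> /(congr1 (fun p : nat => p%:R : rat)); rewrite natrD natr_bin2.
have -> : (\sum_(j < k) n j)%:R = A by rewrite natr_sum.
have -> : (\sum_(j < k) \sum_(q < n j) (q * k + j))%:R = k%:R * (C - A) / 2 + B :> rat.
  rewrite natr_sum -sumrB mulr_sumr mulr_suml -big_split /=; apply: eq_bigr => j _.
  rewrite natr_sum; under eq_bigr => q _ do rewrite natrD natrM.
  rewrite big_split /= -mulr_suml sum_natr sumr_const card_ord -mulr_natr.
  by ring.
move=> /(canRL (addrK _)) ->; field.
by rewrite /k pnatr_eq0.
Qed.

Theorem theorem1p2 (k m : nat) (hk : (1 <= k)%N) (hm : (1 <= m)%N) :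
  exists S : {fset seq nat},
    (forall la : seq nat, (la \in S) = is_core k (m * k + 1) la) /\
    \sum_(la <- S) (psize la)%:R =
      (m%:R * k%:R * (k%:R - 1) * ((m%:R + 1) * k%:R + 2)) /
      (24 * (m%:R * k%:R + 1)) * ('C((m + 1) * k, k))%:R :> rat.
Proof.
case: k hk => // k' _; set b := (m * k'.+1 + 1)%N.
pose ballots := [pred z : k'.+1.-tuple 'I_b.+1 | composition z && ballot z].
exists [fset core_of z | z in ballots]%fset; split=> [la|].
  apply/imfsetP/idP => [[z /andP [cz bz] ->]|]; first exact: core_of_is_core.
  by move/core_of_surj => [z zb <-]; exists z.
rewrite big_imfset /=; last exact: core_of_inj.
transitivity (\sum_(z : k'.+1.-tuple 'I_b.+1 | composition z && ballot z)
    (energy z / (4 * k'.+1%:R ^+ 2) - (k'.+1%:R ^+ 2 - 1) / 24)).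
  rewrite (perm_big (enum ballots)) /=; last first.
    by apply: uniq_perm; rewrite ?enum_finmem_uniq ?enum_uniq // => z;
      rewrite enum_finmemE mem_enum.
  by rewrite big_enum; apply: eq_bigr => z /andP [cz bz]; exact: psize_core_of_energy.
have kb : coprime k'.+1 b by rewrite /b /coprime gcdnMDl gcdn1.
have kE : k'.+1%:R = k'%:R + 1 :> rat by rewrite -natr1.
have kn0 : k'.+1%:R != 0 :> rat by rewrite pnatr_eq0.
apply: (mulfI kn0); rewrite sum_ballot //; last by move=> s z; rewrite energy_rotate.
have cE : \sum_(z : k'.+1.-tuple 'I_b.+1 | composition z) ((k'.+1%:R ^+ 2 - 1) / 24) =
    (k'.+1%:R ^+ 2 - 1) / 24 * 'C(k' + b, k')%:R :> rat.
  by rewrite -card_compositions mulr_sumr; apply: eq_bigr => z _; rewrite mulr1.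
rewrite big_split /= sumrN -mulr_suml sum_energy cE.
have bE : b%:R = m%:R * k'.+1%:R + 1 :> rat by rewrite natrD natrM.
(* Absorption: for [n = k' + b], the product of [k'.+1] and ['C(n, k'.+1)] is that of [n - k' = b]
   and ['C(n, k')]. *)
have binE : 'C(k' + b, k')%:R * b%:R = k'.+1%:R * 'C((m + 1) * k'.+1, k'.+1)%:R :> rat.
  have -> : ((m + 1) * k'.+1 = k' + b)%N by rewrite /b; lia.
  by rewrite -!natrM mul_bin_left addKn mulnC.
have {}binE : 'C((m + 1) * k'.+1, k'.+1)%:R =
    'C(k' + b, k')%:R * b%:R / k'.+1%:R :> rat by rewrite binE mulrC mulKf.
rewrite binE bE kE; field.
by rewrite -kE -bE !pnatr_eq0 /b addn1.
Qed.
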